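(* Let $\mathcal{S}$ be a selection function, let $L$ be an $\mathcal{S}$-frame, and let $\downarrow: L\to \mathcal{H}_{\mathcal{S}}L$, $a\mapsto\, \downarrow a=\{t\in L: t\le a\}$, be the embedding of $L$ into its free frame $\mathcal{H}_{\mathcal{S}}L$ (the frame of all $\mathcal{S}$-ideals of $L$), regarded as an $\mathcal{S}$-frame map. Then: (a) The map $\downarrow$ has a right adjoint if and only if $\downarrow$ is an isomorphism. (b) The map $\downarrow$ is closed if and only if $\downarrow$ is an isomorphism. (c) The map $\downarrow$ has a left adjoint if and only if $L$ is a complete lattice. (d) The map $\downarrow$ is open if and only if $L$ is a frame.
   Context: A meet-semilattice is a partially ordered set in which all finite subsets (including $\emptyset$) have a meet; its top element is $1$. A meet-semilattice map preserves finite meets (including $1$). A sub meet-semilattice is a subset for which the inclusion is a meet-semilattice map. A selection function $\mathcal{S}$ assigns to each meet-semilattice $A$ a collection $\mathcal{S}A$ of subsets of $A$ (the designated subsets of $A$), such that for all meet-semilattices $A,B$: (S1) $\{x\}\in\mathcal{S}A$ for all $x\in A$. (S2) If $G,H\in\mathcal{S}A$ then $\{x\wedge y: x\in G,y\in H\}\in\mathcal{S}A$. (S2)$'$ If $G,H\in\mathcal{S}A$ then $\{x\vee y:x\in G,y\in H\}\in\mathcal{S}A$ (when these joins exist). (S3) If $G\in\mathcal{S}A$ and, for all $x\in G$, $x=\bigvee H_x$ for some $H_x\in\mathcal{S}A$, then $\bigcup_{x\in G}H_x\in\mathcal{S}A$. (S4) For any meet-semilattice map $f:A\to B$, $\mathcal{S}(f[A])=\{f[G]:G\in\mathcal{S}A\}\subseteq\mathcal{S}B$.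 (SSub) If $B$ is a sub meet-semilattice of $A$, $G\subseteq B$ and $G\in\mathcal{S}A$, then $G\in\mathcal{S}B$. (SFin) Every finite subset of $A$ is in $\mathcal{S}A$. (SCov) If $G\subseteq H$ and $H\in\mathcal{S}A$ with $\bigvee H=1$, then $G\in\mathcal{S}A$. (SRef) If $X,Y\subseteq A$, $X\in\mathcal{S}A$ and $X\le Y$ (i.e. each $x\in X$ lies below some $y\in Y$), then there is $C\in\mathcal{S}A$ with $X\le C\subseteq Y$. An $\mathcal{S}$-frame is a meet-semilattice $L$ in which every designated subset has a join and $a\wedge\bigvee B=\bigvee_{b\in B}(a\wedge b)$ for all $a\in L$ and all designated $B\subseteq L$. In particular $L$ is a bounded distributive lattice. An $\mathcal{S}$-frame map is a meet-semilattice map $f:L\to M$ between $\mathcal{S}$-frames with $f(\bigvee B)=\bigvee f[B]$ for all designated $B\subseteq L$. A frame is a complete lattice in which binary meet distributes over arbitrary joins; every frame is an $\mathcal{S}$-frame. An $\mathcal{S}$-ideal of an $\mathcal{S}$-frame $L$ is a non-empty downset $J\subseteq L$ such that $\bigvee X\in J$ whenever $X\subseteq J$ is a designated subset of $L$. $\mathcal{H}_{\mathcal{S}}L$ is the set of all $\mathcal{S}$-ideals of $L$ ordered by inclusion; it is a frame (the free frame over $L$), and $\downarrow:L\to\mathcal{H}_{\mathcal{S}}L$ is an injective $\mathcal{S}$-frame map. For an $\mathcal{S}$-frame $L$ and $a\in L$, put $\nabla_a=\{(x,y)\in L\times L:x\vee a=y\vee a\}$ and $\Delta_a=\{(x,y)\in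 L\times L:x\wedge a=y\wedge a\}$. Let $h:L\to M$ be an $\mathcal{S}$-frame map. A right adjoint of $h$ is a function $r:M\to L$ with $h(x)\le m\iff x\le r(m)$ for all $x\in L,m\in M$. A left adjoint of $h$ is a function $l:M\to L$ with $l(m)\le x\iff m\le h(x)$ for all $x\in L,m\in M$. The map $h$ is closed if for every $m\in M$ there is $x\in L$ with $(h\times h)^{-1}(\nabla_m)=\nabla_x$; it is open if for every $m\in M$ there is $x\in L$ with $(h\times h)^{-1}(\Delta_m)=\Delta_x$. *)

(* Defs.v *)
From HB Require Import structures.
From mathcomp Require Import all_boot all_order.
From mathcomp Require Import boolp classical_sets functions cardinality.

Set Implicit Arguments.
Unset Strict Implicit.
Unset Printing Implicit Defensive.

Import Order.Theory.

Local Open Scope classical_set_scope.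
Local Open Scope order_scope.

(* A meet-semilattice (with top) is a [tMeetSemilatticeType].  Such a type has
   no join operation: "x is the join of B" is written [supremums B x]. *)

Definition is_msl_map d (A : tMeetSemilatticeType d) d'
    (B : tMeetSemilatticeType d') (f : A -> B) : Prop :=
  f \top = \top /\ forall x y, f (Order.meet x y) = Order.meet (f x) (f y).

Record sub_msl d (A : tMeetSemilatticeType d) := SubMsl {
  sub_msl_set :> set A;
  sub_mslT : sub_msl_set \top;
  sub_mslI : forall x y,
    sub_msl_set x -> sub_msl_set y -> sub_msl_set (Order.meet x y)
}.

Definition sub_msl_sort d (A : tMeetSemilatticeType d) (B : sub_msl A) : Type :=
  {x : A | x \in sub_msl_set B}.

Section SubMslTheory.
Context d (A : tMeetSemilatticeType d) (B : sub_msl A).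
Local Notation T := (sub_msl_sort B).

HB.instance Definition _ := SubChoice.copy T {x : A | x \in sub_msl_set B}.
HB.instance Definition _ := [SubChoice_isSubPOrder of T by <: with d].

Lemma sub_msl_topP : (\top : A) \in sub_msl_set B.
Proof. by rewrite inE; apply: sub_mslT. Qed.

Lemma sub_msl_meetP (x y : T) : Order.meet (val x) (val y) \in sub_msl_set B.
Proof.
rewrite inE; apply: sub_mslI; rewrite -in_setE; exact: valP.
Qed.

Definition sub_msl_top : T := Sub (\top : A) sub_msl_topP.

Definition sub_msl_meet (x y : T) : T :=
  Sub (Order.meet (val x) (val y)) (sub_msl_meetP x y).

Lemma sub_msl_lexI (x y z : T) :
  (x <= sub_msl_meet y z) = (x <= y) && (x <= z).
Proof. by rewrite -!Order.le_val SubK lexI. Qed.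

Lemma sub_msl_lex1 (x : T) : x <= sub_msl_top.
Proof. by rewrite -Order.le_val SubK lex1. Qed.

HB.instance Definition _ :=
  Order.POrder_isMeetSemilattice.Build d T sub_msl_lexI.
HB.instance Definition _ := Order.hasTop.Build d T sub_msl_lex1.

Definition sub_msl_val : T -> A := val.

End SubMslTheory.

Arguments sub_msl_val {d A} B.

Section ImageMsl.
Context d (A : tMeetSemilatticeType d) d' (B : tMeetSemilatticeType d').
Context (f : A -> B) (hf : is_msl_map f).

Lemma image_mslT : (f @` setT) \top.
Proof. by exists \top => //; case: hf. Qed.

Lemma image_mslI x y :
  (f @` setT) x -> (f @` setT) y -> (f @` setT) (Order.meet x y).
Proof.
by move=> [a _ <-] [b _ <-]; exists (Order.meet a b) => //; case: hf.
Qed.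

Definition image_msl : sub_msl B := SubMsl image_mslT image_mslI.

End ImageMsl.

(* [S _ A G] reads "G is a designated subset of A". *)
Definition designation : Type :=
  forall d (A : tMeetSemilatticeType d), set (set A).

Record is_selection (S : designation) : Prop := IsSelection {
  sel_S1 : forall d (A : tMeetSemilatticeType d) (x : A), S _ A [set x];
  sel_S2 : forall d (A : tMeetSemilatticeType d) (G H : set A),
    S _ A G -> S _ A H -> S _ A [set Order.meet x y | x in G & y in H];
  sel_S2' : forall d (A : tMeetSemilatticeType d) (G H : set A),
    S _ A G -> S _ A H ->
    (forall x y, G x -> H y -> exists z, supremums [set x; y] z) ->
    S _ A [set z | exists x y, [/\ G x, H y & supremums [set x; y] z]];
  sel_S3 : forall d (A : tMeetSemilatticeType d) (G : set A) (H : A -> set A),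
    S _ A G -> (forall x, G x -> S _ A (H x) /\ supremums (H x) x) ->
    S _ A (\bigcup_(x in G) H x);
  sel_S4 : forall d (A : tMeetSemilatticeType d) d'
      (B : tMeetSemilatticeType d') (f : A -> B) (hf : is_msl_map f),
    [set sub_msl_val (image_msl hf) @` K
       | K in S _ (sub_msl_sort (image_msl hf))] = [set f @` G | G in S _ A] /\
    [set f @` G | G in S _ A] `<=` S _ B;
  sel_Sub : forall d (A : tMeetSemilatticeType d) (B : sub_msl A) (G : set A),
    G `<=` B -> S _ A G ->
    S _ (sub_msl_sort B) (sub_msl_val B @^-1` G);
  sel_Fin : forall d (A : tMeetSemilatticeType d) (G : set A),
    finite_set G -> S _ A G;
  sel_Cov : forall d (A : tMeetSemilatticeType d) (G H : set A),
    G `<=` H -> S _ A H -> supremums H \top -> S _ A G;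
  sel_Ref : forall d (A : tMeetSemilatticeType d) (X Y : set A),
    S _ A X -> (forall x, X x -> exists2 y, Y y & x <= y) ->
    exists C, [/\ S _ A C, forall x, X x -> exists2 c, C c & x <= c
                & C `<=` Y]
}.

Definition is_sframe (S : designation) d (L : tMeetSemilatticeType d) : Prop :=
  (forall B, S _ L B -> exists x, supremums B x) /\
  (forall (a : L) B x, S _ L B -> supremums B x ->
     supremums [set Order.meet a b | b in B] (Order.meet a x)).

Definition is_sframe_map (S : designation) d (L : tMeetSemilatticeType d) d'
    (M : tMeetSemilatticeType d') (f : L -> M) : Prop :=
  is_msl_map f /\
  forall B x, S _ L B -> supremums B x -> supremums (f @` B) (f x).

Definition is_sframe_iso (S : designation) d (L : tMeetSemilatticeType d) d'
    (M : tMeetSemilatticeType d') (f : L -> M) : Prop :=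
  is_sframe_map S f /\
  exists g : M -> L, [/\ is_sframe_map S g, cancel f g & cancel g f].

Definition is_complete_lattice d (L : porderType d) : Prop :=
  forall B : set L, (exists x, supremums B x) /\ (exists x, infimums B x).

Definition is_frame d (L : tMeetSemilatticeType d) : Prop :=
  is_complete_lattice L /\
  forall (a : L) B x, supremums B x ->
    supremums [set Order.meet a b | b in B] (Order.meet a x).

Definition is_sideal (S : designation) d (L : tMeetSemilatticeType d)
    (J : set L) : Prop :=
  [/\ J !=set0,
      forall x y, x <= y -> J y -> J x &
      forall X x, X `<=` J -> S _ L X -> supremums X x -> J x].

(* The set H_S L of S-ideals, ordered by inclusion. *)
Record sideal (S : designation) d (L : tMeetSemilatticeType d) := SIdeal {
  sideal_set :> set L;
  sidealP : is_sideal S sideal_set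
}.

Fact sideal_display : Order.disp_t. Proof. exact: Order.Disp tt tt. Qed.

Section SIdealTheory.
Context (S : designation) d (L : tMeetSemilatticeType d).
Local Notation H := (sideal S L).
Implicit Types (I J K : H) (a : L).

HB.instance Definition _ := gen_eqMixin H.
HB.instance Definition _ := gen_choiceMixin H.

Lemma sideal_eq I J : sideal_set I = sideal_set J -> I = J.
Proof.
case: I J => [I hI] [J hJ] /= IJ; case: _ / IJ hJ => hJ.
by rewrite (Prop_irrelevance hI hJ).
Qed.

Definition sideal_le I J : bool := `[< (I : set L) `<=` J >].

Lemma sideal_le_refl : reflexive sideal_le.
Proof. by move=> I; apply/asboolP. Qed.

Lemma sideal_le_anti : antisymmetric sideal_le.
Proof.
by move=> I J /andP[/asboolP IJ /asboolP JI]; apply/sideal_eq/seteqP.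
Qed.

Lemma sideal_le_trans : transitive sideal_le.
Proof.
by move=> J I K /asboolP IJ /asboolP JK; apply/asboolP/(subset_trans IJ).
Qed.

HB.instance Definition _ := Order.Le_isPOrder.Build sideal_display H
  sideal_le_refl sideal_le_anti sideal_le_trans.

Lemma sideal_leP I J : reflect ((I : set L) `<=` J) (I <= J).
Proof. exact: asboolP. Qed.

Lemma is_sidealT : is_sideal S (setT : set L).
Proof. by split=> //; exists \top. Qed.

Lemma is_sidealI I J : is_sideal S ((I : set L) `&` J)%classic.
Proof.
case: I J => [I [[x Ix] Idown Ijoin]] [J [[y Jy] Jdown Jjoin]] /=; split.
- by exists (Order.meet x y); split;
    [apply: Idown Ix; exact: leIl | apply: Jdown Jy; exact: leIr].
- by move=> u v uv [Iv Jv]; split; [apply: Idown Iv | apply: Jdown Jv].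
- move=> X u XIJ SX uX; split.
  + by apply: Ijoin uX => // z /XIJ[].
  + by apply: Jjoin uX => // z /XIJ[].
Qed.

Definition sideal_top : H := SIdeal is_sidealT.
Definition sideal_meet I J : H := SIdeal (is_sidealI I J).

Lemma sideal_lexI I J K : (I <= sideal_meet J K) = (I <= J) && (I <= K).
Proof.
apply/sideal_leP/andP => [IJK|[/sideal_leP IJ /sideal_leP IK]].
- by split; apply/sideal_leP => x /IJK[].
- by move=> x Ix; split; [apply: IJ | apply: IK].
Qed.

Lemma sideal_lex1 I : I <= sideal_top.
Proof. exact/sideal_leP. Qed.

HB.instance Definition _ :=
  Order.POrder_isMeetSemilattice.Build sideal_display H sideal_lexI.
HB.instance Definition _ := Order.hasTop.Build sideal_display H sideal_lex1.

Lemma is_sideal_down a : is_sideal S [set t | t <= a].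
Proof.
split; first by exists a => /=.
- by move=> x y xy /=; apply: le_trans.
- by move=> X x Xa _ [_ /(_ a)]; apply=> t /Xa.
Qed.

Definition sideal_down a : H := SIdeal (is_sideal_down a).

End SIdealTheory.

Arguments sideal_down S {d L} a.

Lemma frame_sframe (S : designation) d (L : tMeetSemilatticeType d) :
  is_frame L -> is_sframe S L.
Proof.
move=> [Lc Ld]; split=> [B _|a B x _]; last exact: Ld.
by have [] := Lc B.
Qed.

Lemma sideal_frame (S : designation) d (L : tMeetSemilatticeType d) :
  is_selection S -> is_sframe S L -> is_frame (sideal S L).
Proof.
move=> hS [Lsup Ldist].
have [o oP] : exists o : L, forall J : sideal S L, sideal_set J o.
  have S0 : S _ L set0 by apply: sel_Fin.
  have [o supo] := Lsup _ S0; exists o => -[J [? ? Jj]] /=.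
  by apply: Jj S0 supo => ?.
have bigI_sideal (F : set (sideal S L)) :
    is_sideal S [set x | forall K : sideal S L, F K -> sideal_set K x].
  split.
  - by exists o => K _; exact: oP.
  - by move=> x y xy yF K FK; case: K FK (yF K FK) => K [? Kd ?] FK /= /Kd; apply.
  - move=> X x XF SX supx K FK; have XK : X `<=` sideal_set K.
      by move=> t /XF /(_ _ FK).
    by case: K {FK} XK => K [? ? Kj] /= XK; apply: Kj XK SX supx.
pose bigI F : sideal S L := SIdeal (bigI_sideal F).
have bigI_inf F : infimums F (bigI F).
  split=> [K FK|K KF]; first by apply/sideal_leP => x /(_ _ FK).
  by apply/sideal_leP => x Kx J FJ; move/sideal_leP: (KF _ FJ); apply.
have bigU_sup F : supremums F (bigI (ubound F)).
  have [lbU glbU] := bigI_inf (ubound F).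
  by split=> [K FK|K UK]; [apply: glbU => J; apply | exact: lbU].
split=> [F|I F U [ubU lubU]].
  by split; [exists (bigI (ubound F)) | exists (bigI F)].
split=> [_ [J FJ <-]|K ubK]; first by apply: leI2 => //; exact: ubU.
have imp_sideal : is_sideal S
    [set x | forall i, sideal_set I i -> sideal_set K (Order.meet i x)].
  case: K {ubK} => K [[k Kk] Kd Kj] /=; split.
  - by exists k => i _; apply: Kd Kk; exact: leIr.
  - by move=> x y xy yP i /yP; apply: Kd; exact: leI2.
  - move=> X x XP SX supx i Ii; apply: (Kj [set Order.meet i b | b in X]).
    + by move=> _ [b Xb <-]; exact: XP.
    + have := sel_S2 hS (sel_S1 hS i) SX; congr (S _ L _).
      apply/seteqP; split=> [_ [_ -> [b Xb <-]]|_ [b Xb <-]].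
        by exists b.
      by exists i => //; exists b.
    + exact: Ldist.
have leU : U <= (SIdeal imp_sideal : sideal S L).
  apply: lubU => J FJ; apply/sideal_leP => x Jx i Ii.
  have /sideal_leP := ubK _ (ex_intro2 _ _ J FJ erefl); apply; split.
    by case: I Ii {ubK imp_sideal} => I [? Id ?] /= Ii; apply: Id Ii; exact: leIl.
  by case: J Jx {FJ} => J [? Jd ?] /= Jx; apply: Jd Jx; exact: leIr.
apply/sideal_leP => x [Ix /(sideal_leP _ _ leU)/(_ _ Ix)].
by rewrite meetxx.
Qed.

Lemma sideal_down_sframe_map (S : designation) d (L : tMeetSemilatticeType d) :
  is_sframe_map S (@sideal_down S d L).
Proof.
split; first split.
- apply/sideal_eq/seteqP; split=> x //= _; exact: lex1.
- move=> x y; apply/sideal_eq/seteqP; split=> t /=.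
    by rewrite lexI => /andP.
  by move=> [/= tx ty]; rewrite lexI tx.
- move=> B x SB supx; split=> [_ [b Bb <-]|K ubK].
    apply/sideal_leP => t /= tb; apply: le_trans tb _.
    by case: supx => + _; apply.
  apply/sideal_leP => t /= tx.
  have BK : B `<=` sideal_set K.
    move=> b Bb; have /sideal_leP := ubK _ (ex_intro2 _ _ b Bb erefl).
    by apply; exact: lexx.
  case: K {ubK} BK => K [_ Kd Kj] /= BK; apply: Kd tx _.
  exact: Kj BK SB supx.
Qed.

(* In an S-frame binary joins exist and are unique, so the two joins are equal
   iff they have a common value [z]. *)
Definition nabla d (L : tMeetSemilatticeType d) (a : L) : set (L * L) :=
  [set p | exists z, supremums [set p.1; a] z /\ supremums [set p.2; a] z].

Definition delta d (L : tMeetSemilatticeType d) (a : L) : set (L * L) :=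
  [set p | Order.meet p.1 a = Order.meet p.2 a].

Section Maps.
Context d (L : tMeetSemilatticeType d) d' (M : tMeetSemilatticeType d').
Implicit Type h : L -> M.

Definition has_right_adjoint h : Prop :=
  exists r : M -> L, forall x m, h x <= m <-> x <= r m.

Definition has_left_adjoint h : Prop :=
  exists l : M -> L, forall x m, l m <= x <-> m <= h x.

Definition is_closed_map h : Prop :=
  forall m : M, exists x : L,
    (fun p => (h p.1, h p.2)) @^-1` nabla m = nabla x.

Definition is_open_map h : Prop :=
  forall m : M, exists x : L,
    (fun p => (h p.1, h p.2)) @^-1` delta m = delta x.

End Maps.

(* Main.v *)
Require Import Defs.
From mathcomp Require Import all_boot all_order.
From mathcomp Require Import boolp classical_sets cardinality.

(** An S-ideal [J] lies below [↓x] exactly when [x] is an upper bound of [J],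
    and above [↓x] exactly when [x] is in [J].  Hence a right adjoint, or an [x]
    with [(↓ × ↓)^-1 ∇_J = ∇_x] (test against pairs [(a, 0)]), forces
    [J = ↓x]; a left adjoint, or an [x] with [(↓ × ↓)^-1 Δ_J = Δ_x] (test
    against pairs [(1, a)]), forces [x] to be the join of [J].  Applied to the
    S-ideal generated by a set, the latter yields all joins of [L]; if [x] is
    the join of [B] and [u] bounds the meets of [a] with [B], then the pair
    [(a, a ∧ u)] gives [a ∧ x <= u], as [{t | a ∧ t <= u}] is an S-ideal. *)

Import Order.Theory.

Local Open Scope classical_set_scope.
Local Open Scope order_scope.

Lemma supremums_uniq {d} {T : porderType d} {A : set T} {x y} :
  supremums A x -> supremums A y -> x = y.
Proof.
by move=> [ubx lubx] [uby luby]; apply: le_anti; rewrite lubx ?luby.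
Qed.

Lemma supremums2_le {d} {T : porderType d} {x y : T} :
  x <= y -> supremums [set x; y] y.
Proof.
by move=> xy; split=> [_ [->|->] //|u]; apply; right.
Qed.

Lemma sups_complete_lattice {d} {T : porderType d} :
  (forall B : set T, exists x, supremums B x) -> is_complete_lattice T.
Proof.
move=> sups B; split; first exact: sups.
have [x [ubx lubx]] := sups (lbound B).
exists x; split=> [b Bb|y /ubx //].
by apply: lubx => y; apply.
Qed.

Section Down.
Set Implicit Arguments.
Unset Strict Implicit.
Unset Printing Implicit Defensive.
Context (S : designation) d (L : tMeetSemilatticeType d).
Implicit Types (a b x u : L) (J K : sideal S L) (B : set L).
Local Notation dn := (@sideal_down S d L).

Lemma sideal_downP a J : dn a <= J <-> sideal_set J a.
Proof.
split=> [/sideal_leP|Ja]; first by apply; exact: lexx.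
by apply/sideal_leP => t; case: J Ja => J [_ Jd _] /= Ja /Jd; apply.
Qed.

Lemma le_sideal_down J a : J <= dn a <-> ubound (sideal_set J) a.
Proof. by split=> [/sideal_leP|ubJ]; last exact/sideal_leP. Qed.

Lemma sideal_down_le a b : (dn a <= dn b) = (a <= b).
Proof. by apply/idP/idP => [/sideal_downP|ab] //; apply/sideal_downP. Qed.

Lemma sideal_down_inj : injective dn.
Proof. by move=> a b ab; apply: le_anti; rewrite -!sideal_down_le ab lexx. Qed.

(** As [dn] preserves and reflects the order, surjectivity makes it an order isomorphism, whose
    inverse then respects meets and joins. *)
Lemma sframe_iso_downP :
  is_sframe_iso S dn <-> forall J, exists a, dn a = J.
Proof.
split=> [[_ [g [_ _ gK]]] J|surj]; first by exists (g J).
have [g gK] := choice surj.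
have [[dnT dnI] _] := sideal_down_sframe_map S L.
split; first exact: sideal_down_sframe_map.
exists g; split=> // [|a]; last by apply: sideal_down_inj; rewrite gK.
split; first split.
- by apply: sideal_down_inj; rewrite gK dnT.
- by move=> J K; apply: sideal_down_inj; rewrite dnI !gK.
- move=> B J _ [ubJ lubJ]; split=> [_ [K BK <-]|u ubu].
    by rewrite -sideal_down_le !gK; exact: ubJ.
  rewrite -sideal_down_le gK; apply: lubJ => K BK.
  by rewrite -[K]gK sideal_down_le; apply: ubu; exists K.
Qed.

Lemma right_adjoint_downP : has_right_adjoint dn <-> is_sframe_iso S dn.
Proof.
rewrite sframe_iso_downP; split=> [[r rP] J|surj].
  exists (r J); apply: le_anti; apply/andP; split; first exact/rP.
  by apply/le_sideal_down => a /sideal_downP /rP.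
have [r rK] := choice surj.
by exists r => a J; rewrite -sideal_down_le rK.
Qed.

(** Since [J <= dn x] says that [x] bounds [J], the adjunction at [J] is the universal property of a
    least upper bound. *)
Lemma left_adjoint_supremums (l : sideal S L -> L) :
  (forall x J, l J <= x <-> J <= dn x) <->
  forall J, supremums (sideal_set J) (l J).
Proof.
split=> [lP J|lsup x J].
  by split=> [|u /le_sideal_down /lP //]; apply/le_sideal_down/lP.
have [ubl lubl] := lsup J; rewrite le_sideal_down; split=> [lx a Ja|/lubl //].
exact: le_trans (ubl _ Ja) lx.
Qed.

Hypotheses (hS : is_selection S) (hL : is_sframe S L).

(** [J] is the join of the principal S-ideals [dn b], which exists because the S-ideals form a
    frame. *)
Lemma sideal_generated B :
  exists J, forall K, J <= K <-> B `<=` sideal_set K.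
Proof.
have [Hc _] := sideal_frame hS hL.
have [[J [ubJ lubJ]] _] := Hc [set dn b | b in B].
exists J => K; split=> [JK b Bb|BK].
  by apply/sideal_downP/(le_trans _ JK)/ubJ; exists b.
by apply: lubJ => _ [b /BK Kb <-]; apply/sideal_downP.
Qed.

(** Taking [K = dn u] shows that [B] and [J] have the same upper bounds. *)
Lemma generated_supremums B J x :
  (forall K, J <= K <-> B `<=` sideal_set K) ->
  supremums (sideal_set J) x -> supremums B x.
Proof.
move=> JP [ubx lubx].
have BJ : B `<=` sideal_set J by apply/JP.
split=> [b /BJ /ubx //|u ubu].
by apply: lubx; apply/le_sideal_down/JP.
Qed.

Lemma sideal_supremums_complete_lattice :
  (forall J, exists x, supremums (sideal_set J) x) -> is_complete_lattice L.
Proof.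
move=> sups; apply: sups_complete_lattice => B.
have [J JP] := sideal_generated B.
by have [x supx] := sups J; exists x; apply: generated_supremums JP supx.
Qed.

Lemma left_adjoint_downP : has_left_adjoint dn <-> is_complete_lattice L.
Proof.
split=> [[l /left_adjoint_supremums lsup]|Lc].
  by apply: sideal_supremums_complete_lattice => J; exists (l J).
have /choice[l lsup] : forall J, exists x, supremums (sideal_set J) x.
  by move=> J; have [] := Lc (sideal_set J).
by exists l; apply/left_adjoint_supremums.
Qed.

Lemma sframe_join a b : exists z, supremums [set a; b] z.
Proof. by apply: hL.1; apply: sel_Fin. Qed.

Lemma sframe_bot : exists o : L, forall x, o <= x.
Proof.
have [|o [_ lubo]] := hL.1 set0; first exact: sel_Fin.
by exists o => x; exact: lubo.
Qed.

(** Finite sets are designated, so [dn] preserves binary joins; being injective, it also reflects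
    equality between them. *)
Lemma nabla_down a b x : nabla (dn x) (dn a, dn b) <-> nabla x (a, b).
Proof.
have dn_sup y z : supremums [set y; x] z -> supremums [set dn y; dn x] (dn z).
  rewrite -!(image_set1 dn) -image_setU; apply: (sideal_down_sframe_map S L).2.
  by apply: sel_Fin.
split=> /= -[z [za zb]]; last by exists (dn z); split; exact: dn_sup.
have [[u ua] [v vb]] := (sframe_join a x, sframe_join b x).
have uv : u = v.
  apply: sideal_down_inj.
  rewrite (supremums_uniq (dn_sup _ _ ua) za).
  exact: supremums_uniq zb (dn_sup _ _ vb).
by exists u; split=> //; rewrite uv.
Qed.

Lemma closed_downP : is_closed_map dn <-> is_sframe_iso S dn.
Proof.
rewrite sframe_iso_downP; split=> [cl J|surj J]; last first.
  have [x <-] := surj J; exists x.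
  by apply/seteqP; split=> -[a b] /nabla_down.
have [x xP] := cl J; exists x.
have [o oP] := sframe_bot.
have nablaP a b : nabla J (dn a, dn b) <-> nabla x (a, b) by rewrite -xP.
have dnoJ : dn o <= J.
  apply/sideal_downP; case: (J) => K [[k Kk] Kd _] /=.
  exact: Kd (oP k) Kk.
apply: le_anti; apply/andP; split.
  (* From [x ∨ x = o ∨ x] one gets [dn x ∨ J = dn o ∨ J = J]. *)
  have [|K [[ubK _] supK]] := (nablaP x o).2.
    by exists x; split; exact: supremums2_le.
  rewrite (supremums_uniq (supremums2_le dnoJ) supK).
  by apply: ubK; left.
apply/le_sideal_down => a /sideal_downP dnaJ.
(* For [a] in [J], [dn a ∨ J = J = dn o ∨ J], whence [a ∨ x = o ∨ x = x]. *)
have [|z [[ubz _] supz]] := (nablaP a o).1.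
  by exists J; split; exact: supremums2_le.
rewrite (supremums_uniq (supremums2_le (oP x)) supz).
by apply: ubz; left.
Qed.

Lemma delta_downP a b J :
  delta J (dn a, dn b) <->
  forall t, sideal_set J t -> (t <= a) = (t <= b).
Proof.
split=> /= [/(congr1 (@sideal_set _ _ _)) ab t Jt|ab].
  have /seteqP[/(_ t) tab /(_ t) tba] := ab.
  by apply/idP/idP => ?; [case: tab | case: tba].
by apply/sideal_eq/seteqP; split=> t [/= + Jt]; split=> //=;
  [rewrite -ab | rewrite ab].
Qed.

Lemma open_down_supremums J x :
  (fun p => (dn p.1, dn p.2)) @^-1` delta J = delta x ->
  supremums (sideal_set J) x.
Proof.
move=> xP.
have deltaP a b : delta J (dn a, dn b) <-> delta x (a, b) by rewrite -xP.
split=> [a Ja|u ubu].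
  have /deltaP/delta_downP/(_ a Ja) : delta x (\top, x).
    by rewrite /delta /= meet1x meetxx.
  by rewrite lex1 => <-.
(* This pair is in [delta J] because [u] bounds [J]; in [delta x] it reads [x = u ∧ x]. *)
have : delta x (\top, u).
  by apply/deltaP/delta_downP => t /ubu ->; rewrite lex1.
by rewrite /delta /= meet1x => ->; exact: leIl.
Qed.

(** Closure under designated joins is the distributive law of [L]. This S-ideal stands in for a
    Heyting implication [a → u], which [L] may not have. *)
Lemma is_sideal_imp a u : is_sideal S [set t | Order.meet a t <= u].
Proof.
split.
- by exists u; exact: leIr.
- by move=> x y xy /=; apply: le_trans; exact: leI2.
- move=> X x Xu SX supx /=.
  have [_] := hL.2 a X x SX supx.
  by apply=> _ [t /Xu + <-].
Qed.

Lemma open_downP : is_open_map dn <-> is_frame L.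
Proof.
split=> [op|[Lc Ld] J]; last first.
  have [[x supx] _] := Lc (sideal_set J); exists x.
  have [ubx _] := supx.
  (* By distributivity [a ∧ x] is the join of the [a ∧ t] with [t] in [J]; each of these is in [J]
     and below [a], hence below [b]. *)
  have meet_le a b : (forall t, sideal_set J t -> (t <= a) = (t <= b)) ->
      Order.meet a x <= b.
    move=> ab; have [_] := Ld a _ _ supx; apply=> _ [t Jt <-].
    rewrite -ab ?leIl //.
    by case: J Jt {supx ubx ab} => K [_ Kd _] /= Kt; apply: Kd Kt; exact: leIr.
  apply/seteqP; split=> -[a b] /= => [/delta_downP ab|].
    apply: le_anti.
    by rewrite !lexI !leIr !meet_le // => t Jt; rewrite ab.
  rewrite {1}/delta /= => ab; apply/delta_downP => t /ubx tx.
  by have /(congr1 (fun y => t <= y)) := ab; rewrite !lexI tx !andbT.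
split.
  apply: sideal_supremums_complete_lattice => J.
  by have [x /open_down_supremums] := op J; exists x.
move=> a B y supy; split=> [_ [b Bb <-]|u ubu].
  by apply: leI2 => //; exact: supy.1.
have [J JP] := sideal_generated B.
have [x xP] := op J.
have yx : y = x.
  apply: supremums_uniq supy _; apply: generated_supremums JP _.
  exact: open_down_supremums.
have JU : J <= SIdeal (is_sideal_imp a u).
  by apply/JP => b Bb /=; apply: ubu; exists b.
(* If [t] in [J] is below [a], then [t = a ∧ t <= u] by [JU]. *)
have : ((fun p => (dn p.1, dn p.2)) @^-1` delta J) (a, Order.meet a u).
  apply/delta_downP => t Jt; rewrite lexI; case: (boolP (t <= a)) => //= ta.
  have /sideal_leP/(_ _ Jt) /= := JU.
  by rewrite (meet_r ta) => ->.
rewrite xP /delta /= -yx => ->.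
by apply: le_trans (leIl _ _) _; exact: leIr.
Qed.

End Down.

Theorem theorem7p1 (S : designation) (hS : is_selection S)
    (d : Order.disp_t) (L : tMeetSemilatticeType d) (hL : is_sframe S L) :
  let dn : L -> sideal S L := @sideal_down S d L in
  [/\ (* (a) *) has_right_adjoint dn <-> is_sframe_iso S dn,
      (* (b) *) is_closed_map dn <-> is_sframe_iso S dn,
      (* (c) *) has_left_adjoint dn <-> is_complete_lattice L
    & (* (d) *) is_open_map dn <-> is_frame L].
Proof.
split.
- exact: right_adjoint_downP.
- exact: closed_downP.
- exact: left_adjoint_downP.
- exact: open_downP.
Qed.
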